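(* Every orientation of a lattice path matroid is a $GSP$ oriented matroid.
   Context: Lattice path matroids: let $P$ and $Q$ be lattice paths from $(0,0)$ to $(m,r)$ using unit north and east steps, with $P$ never going above $Q$. The associated lattice path matroid has ground set $[m+r]=\{1,\dots,m+r\}$, and its bases are the sets $\{i : \text{the } i\text{-th step of } R \text{ is a north step}\}$, where $R$ ranges over the lattice paths from $(0,0)$ to $(m,r)$ that stay in the region bounded by $P$ and $Q$ (inclusive). A lattice path matroid is any matroid isomorphic to one of these. Let $O$ be an oriented matroid on a finite set $E$. The signed vector of a signed cocircuit $D=(D^+,D^-)$ is the vector in $\{0,1,-1\}^E$ that equals $1$ on $D^+$, $-1$ on $D^-$ and $0$ elsewhere. The coflow lattice of $O$ is the set of all integer linear combinations of signed vectors of signed cocircuits of $O$; its elements are the coflows of $O$. A $\{0,1,-1\}$-coflow is a coflow all of whose entries lie in $\{0,1,-1\}$. An oriented matroid $O$ is $GSP$ (generalized series parallel) if every simple minor of $O$ with nonempty ground set has a nonzero $\{0,1,-1\}$-coflow with at most two non-zero entries. *)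

(* Defs.v *)
From mathcomp Require Import all_boot all_order all_algebra.

Set Implicit Arguments.
Unset Strict Implicit.
Unset Printing Implicit Defensive.

Import GRing.Theory.
Local Open Scope ring_scope.

(* A matroid is presented by its ground set, a subset of a finite type, and   *)
(* its bases. The basis axioms are not bundled: they hold automatically for   *)
(* the systems used below (lattice path matroids, and the underlying matroids *)
(* of oriented matroids and of their minors).                                 *)
Record basis_system (T : finType) := BasisSystem {
  ground : {set T};
  bases : {set {set T}}
}.

Section Matroids.

Variable T : finType.
Implicit Type M : basis_system T.

Definition dependent M (A : {set T}) : bool :=
  (A \subset ground M) && ~~ [exists B in bases M, A \subset B].

Definition circuit M (C : {set T}) : bool := minset (dependent M) C.

(* Loops are the circuits of size 1, parallel pairs the circuits of size 2.   *)
Definition simple_matroid M : Prop :=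
  forall C : {set T}, circuit M C -> (2 < #|C|)%N.

End Matroids.

Section LatticePaths.

Variable n : nat.
Implicit Types P Q R : n.-tuple bool.

(* A path with n steps is the sequence of its steps, true standing for north  *)
(* and false for east. After k steps it is at (k - height P k, height P k).   *)
Definition height P (k : nat) : nat := count id (take k P).

(* Two paths from the origin meet each antidiagonal x + y = k exactly once,   *)
(* so that their relative position is read off from their heights.            *)
Definition never_above P Q : bool :=
  [forall k : 'I_n.+1, (height P k <= height Q k)%N].

Definition north_steps R : {set 'I_n} := [set i | tnth R i].

End LatticePaths.

(* A path with m + r steps ends at (m, r) iff it has exactly r north steps.   *)
Definition lattice_path (m r : nat) (P : (m + r).-tuple bool) : bool :=
  count id P == r.

(* The i-th step, for i in {1, ..., m + r}, has index i - 1 in 'I_(m + r).    *)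
Definition lattice_path_system (m r : nat) (P Q : (m + r).-tuple bool) :
    basis_system 'I_(m + r) :=
  BasisSystem [set: 'I_(m + r)]
    [set north_steps R | R : (m + r).-tuple bool
       & [&& lattice_path R, never_above P R & never_above R Q]].

Definition matroid_iso (U T : finType) (N : basis_system U)
    (M : basis_system T) (f : U -> T) : Prop :=
  [/\ {in ground N &, injective f},
      f @: ground N = ground M
    & bases M = [set f @: B | B : {set U} in bases N]].

Definition lattice_path_matroid (T : finType) (M : basis_system T) : Prop :=
  exists m r : nat, exists P Q : (m + r).-tuple bool,
    [/\ lattice_path P, lattice_path Q, never_above P Q
      & exists f : 'I_(m + r) -> T, matroid_iso (lattice_path_system P Q) M f].

Definition signed_set (T : finType) : Type := ({set T} * {set T})%type.

(* Oriented matroids are presented by their signed cocircuits. This structure *)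
(* is only the data, so that deletion and contraction are plain operations;   *)
(* the axioms are in oriented_matroid.                                        *)
Record signed_system (T : finType) := SignedSystem {
  sground : {set T};
  cocircuits : {set signed_set T}
}.

Section OrientedMatroids.

Variable T : finType.
Implicit Types (O N : signed_system T) (D X Y Z : signed_set T).

Definition supp X : {set T} := X.1 :|: X.2.
Definition sopp X : signed_set T := (X.2, X.1).
Definition srestrict X (A : {set T}) : signed_set T := (X.1 :&: A, X.2 :&: A).

Record oriented_matroid O : Prop := OrientedMatroid {
  om_ground : forall X, X \in cocircuits O -> supp X \subset sground O;
  om_disjoint : forall X, X \in cocircuits O -> [disjoint X.1 & X.2];
  om_nonempty : forall X, X \in cocircuits O -> supp X != set0;
  om_symmetric : forall X, X \in cocircuits O -> sopp X \in cocircuits O;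
  om_incomparable : forall X Y, X \in cocircuits O -> Y \in cocircuits O ->
    supp X \subset supp Y -> X = Y \/ X = sopp Y;
  om_elimination : forall X Y (e : T),
    X \in cocircuits O -> Y \in cocircuits O -> X <> sopp Y ->
    e \in X.1 -> e \in Y.2 ->
    exists Z, [/\ Z \in cocircuits O,
                  Z.1 \subset (X.1 :|: Y.1) :\ e
                & Z.2 \subset (X.2 :|: Y.2) :\ e]
}.

(* The matroid whose cocircuits are the supports of the signed cocircuits:    *)
(* its bases are the minimal sets meeting all cocircuits.                     *)
Definition underlying O : basis_system T :=
  BasisSystem (sground O)
    [set B | minset [pred A : {set T} |
                 [forall D in cocircuits O, A :&: supp D != set0]] B].

Definition orientation_of O (M : basis_system T) : Prop :=
  oriented_matroid O /\ underlying O = M.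

Definition contract O (A : {set T}) : signed_system T :=
  SignedSystem (sground O :\: A)
    [set D in cocircuits O | [disjoint supp D & A]].

Definition min_nonempty (F : {set signed_set T}) : {set signed_set T} :=
  [set X in F | (supp X != set0) &&
     [forall Y in F, (supp Y != set0) ==> ~~ (supp Y \proper supp X)]].

Definition delete O (A : {set T}) : signed_system T :=
  SignedSystem (sground O :\: A)
    (min_nonempty [set srestrict D (~: A) | D in cocircuits O]).

Definition minor O N : Prop :=
  exists A B : {set T},
    [/\ A \subset sground O, B \subset sground O, [disjoint A & B]
      & N = delete (contract O A) B].

Definition signed_vector D : {ffun T -> int} :=
  [ffun e => if e \in D.1 then 1 else if e \in D.2 then -1 else 0].

(* Vectors are indexed by the whole of T; coflows vanish off the ground set.   *)
Definition coflow O (v : {ffun T -> int}) : Prop :=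
  exists c : signed_set T -> int,
    v = \sum_(D in cocircuits O) signed_vector D *~ c D.

Definition GSP O : Prop :=
  forall N, minor O N -> simple_matroid (underlying N) -> sground N != set0 ->
  exists v : {ffun T -> int},
    [/\ coflow N v,
        forall e, v e \in [:: 0; 1; -1],
        v != 0
      & (#|[set e | v e != 0]| <= 2)%N].

End OrientedMatroids.

(* Main.v *)
Require Import Defs.
From mathcomp Require Import all_boot all_order all_algebra.

(* A minor N = O/A\E of rank rho >= 2 of an oriented lattice path matroid inherits
   the description of bases by bounds on the number of elements in each initial
   segment. Contracting the leftmost possible rho - 2 elements leaves a rank two
   matroid; if N is simple, then at most one parallel class m of this coline has
   several elements, and unless the last element of N is a coloop there are at
   least two singleton classes. Fix a in m and take cocircuits X, Y through
   distinct singleton classes, positive at a, that disagree in sign on as few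
   elements as possible: elimination shows that they disagree nowhere, so X - Y
   is a coflow supported on those two singletons. *)

Set Implicit Arguments.
Unset Strict Implicit.
Unset Printing Implicit Defensive.

(** * Bases and cocircuits: fundamental cocircuits and elimination *)

Section Bases.

Variables (T : finType) (O : signed_system T).
Hypothesis omO : oriented_matroid O.
Implicit Types (X Y Z U V D F : signed_set T) (A B : {set T}).

Local Notation basis B := (B \in bases (underlying O)).

Lemma basis_meets B D :
  basis B -> D \in cocircuits O -> B :&: supp D != set0.
Proof. by rewrite inE => /minsetp/forall_inP; apply. Qed.

(** Bases are minimal transversals of the cocircuit supports, so [B :\ h] misses some cocircuit; as
    [B] meets it, they share [h] alone. *)
Lemma fundamental_cocircuit B h : basis B -> h \in B ->
  exists2 D, D \in cocircuits O & B :&: supp D = [set h].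
Proof.
move=> Bb hB; have := Bb; rewrite inE => /minsetP[_ minB].
have [/(minB _)|] := boolP [forall D in cocircuits O, (B :\ h) :&: supp D != set0].
  by move=> /(_ (subsetDl _ _)) eB; move: hB; rewrite -eB !inE eqxx.
rewrite negb_forall_in => /exists_inP[D Dc /negPn/eqP D0]; exists D => //.
have /set0Pn[e /setIP[eB eD]] := basis_meets Bb Dc.
have only x : x \in B -> x \in supp D -> x = h.
  move=> xB xD; apply/eqP/idP/negPn/negP => xh.
  by move/setP/(_ x): D0; rewrite !inE xh xB; move: xD; rewrite inE => ->.
apply/eqP; rewrite eqEsubset; apply/andP; split.
  by apply/subsetP=> x /setIP[xB xD]; rewrite (only x) ?set11.
by rewrite sub1set inE hB -(only e).
Qed.

Lemma supp_sopp X : supp (sopp X) = supp X.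
Proof. by rewrite /supp setUC. Qed.

Lemma soppK X : sopp (sopp X) = X.
Proof. by case: X. Qed.

Lemma in_supp X e : (e \in supp X) = (e \in X.1) || (e \in X.2).
Proof. by rewrite inE. Qed.

(** Unsigned weak elimination: passing to opposites gives [e] opposite signs in the two cocircuits,
    and excluding both [X = Y] and [X = sopp Y] keeps the signed axiom applicable in every case. *)
Lemma eliminate X Y e : X \in cocircuits O -> Y \in cocircuits O ->
    X <> Y -> X <> sopp Y -> e \in supp X -> e \in supp Y ->
  exists2 Z, Z \in cocircuits O & supp Z \subset (supp X :|: supp Y) :\ e.
Proof.
move=> Xc Yc XY XsY.
have main X' Y' : X' \in cocircuits O -> Y' \in cocircuits O -> X' <> sopp Y' ->
    supp X' = supp X -> supp Y' = supp Y -> e \in X'.1 -> e \in Y'.2 ->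
    exists2 Z, Z \in cocircuits O & supp Z \subset (supp X :|: supp Y) :\ e.
  move=> Xc' Yc' XY' <- <- eX eY.
  have [Z [Zc /subsetP Z1 /subsetP Z2]] := om_elimination omO Xc' Yc' XY' eX eY.
  exists Z => //; apply/subsetP=> x.
  by rewrite in_supp !inE => /orP[/Z1|/Z2]; rewrite !inE;
    case/andP=> -> /orP[]->; rewrite ?orbT.
have Xs := om_symmetric omO Xc; have Ys := om_symmetric omO Yc.
rewrite !in_supp => /orP[] eX /orP[] eY.
- by apply: (main X (sopp Y)); rewrite ?supp_sopp ?soppK.
- exact: (main X Y).
- by apply: (main (sopp X) (sopp Y)); rewrite ?supp_sopp ?soppK // => /(congr1 (@sopp T)); rewrite soppK.
- by apply: (main (sopp X) Y); rewrite ?supp_sopp // => /(congr1 (@sopp T)); rewrite !soppK.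
Qed.

(** The usual passage from weak to strong elimination, by induction on the size of the union of the
    two supports. When weak elimination loses [f], two eliminations on smaller unions recover it. *)
Lemma strong_eliminate X Y e f : X \in cocircuits O -> Y \in cocircuits O ->
    e \in supp X -> e \in supp Y -> f \in supp X -> f \notin supp Y ->
  exists Z, [/\ Z \in cocircuits O,
    supp Z \subset (supp X :|: supp Y) :\ e & f \in supp Z].
Proof.
have [n] := ubnP #|supp X :|: supp Y|.
elim: n => // n IHn in X Y e f *; rewrite ltnS => leXYn Xc Yc eX eY fX fY.
have ne U V g : g \in supp U -> g \notin supp V -> U <> V /\ U <> sopp V.
  move=> gU gV; split=> eUV; first by rewrite -eUV gU in gV.
  by rewrite -supp_sopp -eUV gU in gV.
have shrink U V g : supp U :|: supp V \subset supp X :|: supp Y ->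
    g \in supp X :|: supp Y -> g \notin supp U :|: supp V ->
    #|supp U :|: supp V| < n.
  move=> sUV gXY gUV; apply: leq_trans leXYn; apply: proper_card.
  by rewrite properE sUV; apply/subsetPn; exists g.
have [XY XsY] := ne _ _ _ fX fY.
have [Z Zc sZ] := eliminate Xc Yc XY XsY eX eY.
have [fZ|fZ] := boolP (f \in supp Z); first by exists Z.
have eZ : e \notin supp Z.
  by apply/negP => /(subsetP sZ); rewrite !inE eqxx.
have /subsetPn[g gZ gX] : ~~ (supp Z \subset supp X).
  apply/negP => sZX; have [XZ XsZ] := ne _ _ _ eX eZ.
  case: (om_incomparable omO Zc Xc sZX) => eZX; first by case: XZ.
  by case: XsZ; rewrite eZX soppK.
have sZ' : supp Z \subset supp X :|: supp Y.
  by apply: subset_trans sZ _; apply: subsetDl.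
have gY : g \in supp Y.
  by move/subsetP/(_ g gZ): sZ'; rewrite inE (negPf gX).
(* Both [Y] and [Z] miss [f], so the induction hypothesis applies: [g] is eliminated and [e] kept.
   The result [W] misses [f] and [g]. *)
have [|W [Wc sW eW]] := IHn Y Z g e _ Yc Zc gY gZ eY eZ.
  apply: (shrink _ _ f); first by rewrite subUset subsetUr.
    by rewrite in_setU fX.
  by rewrite in_setU (negPf fY).
have sW' : supp W \subset supp X :|: supp Y.
  apply: subset_trans sW _; apply: subset_trans (subsetDl _ _) _.
  by rewrite subUset subsetUr.
have gW : g \notin supp W by apply/negP => /(subsetP sW); rewrite !inE eqxx.
have fW : f \notin supp W.
  apply/negP => /(subsetP sW).
  by rewrite in_setD in_setU (negPf fY) (negPf fZ) andbF.
(* Now [X] and [W] both miss [g], so [e] can be eliminated while [f] is kept. *)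
have [|V [Vc sV fV]] := IHn X W e f _ Xc Wc eX eW fX fW.
  apply: (shrink _ _ g); first by rewrite subUset subsetUl.
    by rewrite in_setU gY orbT.
  by rewrite in_setU (negPf gX).
exists V; split=> //; apply: subset_trans sV _; apply: setSD.
by rewrite subUset subsetUl.
Qed.

(** Otherwise eliminating [h] would leave a cocircuit disjoint from [B]. *)
Lemma fundamental_unique B h X Y : basis B ->
    X \in cocircuits O -> Y \in cocircuits O ->
    B :&: supp X = [set h] -> B :&: supp Y = [set h] -> X = Y \/ X = sopp Y.
Proof.
move=> Bb Xc Yc BX BY.
have [hB hX] : h \in B /\ h \in supp X.
  by apply/setIP; rewrite BX set11.
have hY : h \in supp Y by have/setIP[] : h \in B :&: supp Y by rewrite BY set11.
have [|/eqP XY] := eqVneq X Y; first by left.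
have [|/eqP XsY] := eqVneq X (sopp Y); first by right.
have [Z Zc /subsetP sZ] := eliminate Xc Yc XY XsY hX hY.
have /set0Pn[e /setIP[eB /sZ]] := basis_meets Bb Zc.
rewrite in_setD in_set1 in_setU => /andP[/negP eh /orP[] eXY]; case: eh.
  by rewrite -in_set1 -BX inE eB.
by rewrite -in_set1 -BY inE eB.
Qed.

(** * Basis exchange, and sign agreement around a coline *)

Variable r : nat.
Hypothesis card_basis : forall B, basis B -> #|B| = r.

(** A cocircuit missing [g |: B :\ h] would meet [B] only in [h], hence be [D] up to sign and
    contain [g]. So the set is a transversal, and the common size of bases makes it a minimal
    one. *)
Lemma basis_exchange B D h g : basis B -> D \in cocircuits O ->
  B :&: supp D = [set h] -> g \in supp D -> basis (g |: B :\ h).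
Proof.
move=> Bb Dc BD gD.
have [hB hD] : h \in B /\ h \in supp D by apply/setIP; rewrite BD set11.
have [->|gh] := eqVneq g h; first by rewrite setD1K.
have gB : g \notin B.
  by apply: contra gh => gB; rewrite -in_set1 -BD inE gB.
have tr : [pred A | [forall F in cocircuits O, A :&: supp F != set0]]
            (g |: B :\ h).
  apply/forall_inP => F Fc; apply/negP => /eqP F0.
  have notin e : e \in g |: B :\ h -> e \notin supp F.
    by move=> eA; apply/negP => eF; move/setP/(_ e): F0; rewrite in_setI eA eF inE.
  have BF : B :&: supp F = [set h].
    have /set0Pn[e eBF] := basis_meets Bb Fc.
    have only x : x \in B :&: supp F -> x = h.
      case/setIP => xB xF; apply/eqP/idP/negPn/negP => xh.
      by move: (notin x); rewrite !inE xh xB orbT -in_supp xF => /(_ isT).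
    apply/eqP; rewrite eqEsubset sub1set -{2}(only e eBF) eBF andbT.
    by apply/subsetP=> x /only ->; rewrite set11.
  have gF : g \in supp F.
    by case: (fundamental_unique Bb Dc Fc BD BF) gD => ->; rewrite ?supp_sopp.
  by move: (notin g); rewrite gF !inE eqxx => /(_ isT).
have [C minC sC] := minset_exists tr.
have Cb : basis C by rewrite inE.
rewrite (_ : g |: _ = C) //; apply/esym/eqP; rewrite eqEcard sC /=.
by rewrite (card_basis Cb) -(card_basis Bb) cardsU1 !inE (negPf gB) andbF (cardsD1 h B) hB.
Qed.

(** Induction on [#|B :&: supp D|]. If the fundamental cocircuit of a common element [z] contains
    [d], swap [d] for [z]; if not, strong elimination of [z] that keeps [d] gives a cocircuit
    meeting [B] inside [(B :&: supp D) :\ z]. *)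
Lemma cocircuit_exchange B D d : basis B -> D \in cocircuits O ->
    d \in supp D -> d \notin B ->
  exists z, [/\ z \in B, z \in supp D & basis (d |: B :\ z)].
Proof.
move=> Bb; have [n] := ubnP #|B :&: supp D|.
elim: n => // n IHn in D *; rewrite ltnS => leBDn Dc dD dB.
have /set0Pn[z /setIP[zB zD]] := basis_meets Bb Dc.
have [F Fc BF] := fundamental_cocircuit Bb zB.
have zF : z \in supp F by have/setIP[] : z \in B :&: supp F by rewrite BF set11.
have [dF|dF] := boolP (d \in supp F).
  by exists z; split=> //; apply: (basis_exchange Bb Fc).
have [D' [Dc' sD' dD']] := strong_eliminate Dc Fc zD zF dD dF.
have sub : B :&: supp D' \subset (B :&: supp D) :\ z.
  apply/subsetP=> e /setIP[eB /(subsetP sD')].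
  rewrite in_setD in_set1 in_setU in_setD in_set1 in_setI eB.
  case/andP=> ez /orP[->|eF]; first by rewrite ez.
  by case/negP: ez; rewrite -in_set1 -BF inE eB.
have [|y [yB yD' yb]] := IHn D' _ Dc' dD' dB.
  apply: leq_ltn_trans (subset_leq_card sub) _; apply: leq_trans leBDn.
  by rewrite [X in _ < X](cardsD1 z) inE zB zD.
exists y; split=> //.
have/setD1P[_ /setIP[]//] : y \in (B :&: supp D) :\ z.
by apply: (subsetP sub); rewrite in_setI yB.
Qed.

(* The complement of [supp X] is a hyperplane containing [K] and [x]. *)
Definition through (K : {set T}) x X :=
  [&& X \in cocircuits O, [disjoint supp X & K] & x \notin supp X].

Lemma through_meets (I K : {set T}) D g h : I \subset K -> through K g D ->
  basis (g |: (h |: I)) -> (g |: (h |: I)) :&: supp D = [set h].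
Proof.
move=> sIK /and3P[Dc DK gD] gb.
have only e : e \in (g |: (h |: I)) :&: supp D -> e = h.
  case/setIP=> /setU1P[->|/setU1P[->|eI]] eD //; first by rewrite eD in gD.
  by move: (subsetP sIK e eI); rewrite (disjointFr DK eD).
have /set0Pn[e eI] := basis_meets gb Dc.
apply/eqP; rewrite eqEsubset sub1set; apply/andP; split.
  by apply/subsetP=> f /only ->; rewrite set11.
by move: (eI); rewrite (only e eI).
Qed.

Lemma coline_agreement (I K m R : {set T}) a x0 y0 X0 Y0 :
    I \subset K -> a \in m -> [disjoint m & R] ->
    (forall g h, g \in m :|: R -> h \in R -> g != h -> basis (g |: (h |: I))) ->
    (forall g h, g \in m -> h \in m -> ~~ basis (g |: (h |: I))) ->
    x0 \in R -> y0 \in R -> x0 != y0 -> through K x0 X0 -> through K y0 Y0 ->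
  exists x y X Y,
    [/\ [/\ x \in R, y \in R & x != y], through K x X, through K y Y
      & forall e, e \in m :|: R -> e != x -> e != y ->
          (e \in X.1) = (e \in Y.1) /\ (e \in X.2) = (e \in Y.2)].
Proof.
move=> sIK am mR basisR basism x0R y0R xy0 X0x Y0y.
have notboth Z g : Z \in cocircuits O -> g \in Z.1 -> g \notin Z.2.
  by move=> /(om_disjoint omO) /disjointFr dZ /dZ ->.
have mW : {subset m <= m :|: R} by apply/subsetP/subsetUl.
have RW : {subset R <= m :|: R} by apply/subsetP/subsetUr.
have mnR g h : g \in m -> h \in R -> g != h.
  by move=> gm; apply: contraTneq => <-; rewrite (disjointFr mR).
have meet D g h := @through_meets I K D g h sIK.
have meetR D g h : through K g D -> g \in m :|: R -> h \in R -> g != h ->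
    h \in supp D.
  move=> Dg gW hR gh.
  by have/setP/(_ h) := meet _ _ _ Dg (basisR _ _ gW hR gh); rewrite !inE eqxx orbT.
(* If [h] were in the support, it could replace [x0] in the basis formed by [g], [x0] and [I],
   giving a basis excluded by [basism]. *)
have class D g h : through K g D -> g \in m -> h \in m -> through K h D.
  move=> Dg gm hm; have /and3P[Dc DK gD] := Dg; rewrite /through Dc DK /=.
  apply/negP=> hD; have gx := mnR _ _ gm x0R.
  have gb := basisR _ _ (mW _ gm) x0R gx.
  have xD := meetR _ _ _ Dg (mW _ gm) x0R gx.
  have := basis_exchange gb Dc (meet _ _ _ Dg gb) hD.
  have xI : x0 \notin I.
    by apply/negP => /(subsetP sIK); rewrite (disjointFr DK xD).
  rewrite setDUl setU1K // (_ : [set g] :\ x0 = [set g]); last first.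
    by apply/setDidPl; rewrite disjoints1 inE.
  by apply/negP; apply: basism.
have uniq D F g : through K g D -> through K g F -> g \in m :|: R ->
    D = F \/ D = sopp F.
  move=> Dg Fg; have /and3P[Dc _ _] := Dg; have /and3P[Fc _ _] := Fg.
  case/setUP=> gS.
    have gb := basisR _ _ (mW _ gS) x0R (mnR _ _ gS x0R).
    exact: fundamental_unique gb Dc Fc (meet _ _ _ Dg gb) (meet _ _ _ Fg gb).
  have := basisR _ _ (mW _ am) gS (mnR _ _ am gS); rewrite setUCA => gb.
  exact: fundamental_unique gb Dc Fc (meet _ _ _ Dg gb) (meet _ _ _ Fg gb).
have throughN D g : through K g D -> through K g (sopp D).
  by rewrite /through supp_sopp => /and3P[/(om_symmetric omO) -> -> ->].
pose sep X Y := (X.1 :&: Y.2 :|: X.2 :&: Y.1) :&: (m :|: R).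
have elim X Y x y e : through K x X -> through K y Y -> X <> sopp Y ->
    e \in sep X Y -> exists Z, [/\ through K e Z,
      Z.1 \subset X.1 :|: Y.1 & Z.2 \subset X.2 :|: Y.2].
  move=> /and3P[Xc XK _] /and3P[Yc YK _] XY /setIP[eXY _].
  have [Z [Zc eZ Z1 Z2]] : exists Z, [/\ Z \in cocircuits O, e \notin supp Z,
      Z.1 \subset X.1 :|: Y.1 & Z.2 \subset X.2 :|: Y.2].
    case/setUP: eXY => /setIP[eX eY].
      have [Z [Zc Z1 Z2]] := om_elimination omO Xc Yc XY eX eY.
      exists Z; split=> //; rewrite ?in_supp.
      - by apply/norP; split; apply/negP; [move/(subsetP Z1)|move/(subsetP Z2)]; rewrite !inE eqxx.
      - exact: subset_trans Z1 (subsetDl _ _).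
      - exact: subset_trans Z2 (subsetDl _ _).
    have YX : Y <> sopp X by move=> YX; apply: XY; rewrite YX soppK.
    have [Z [Zc Z1 Z2]] := om_elimination omO Yc Xc YX eY eX.
    exists Z; split=> //; rewrite ?in_supp.
    - by apply/norP; split; apply/negP; [move/(subsetP Z1)|move/(subsetP Z2)]; rewrite !inE eqxx.
    - by rewrite setUC; apply: subset_trans Z1 (subsetDl _ _).
    - by rewrite setUC; apply: subset_trans Z2 (subsetDl _ _).
  exists Z; split=> //; rewrite /through Zc eZ andbT /=.
  apply/pred0P=> f /=; apply/negP=> /andP[]; rewrite in_supp => fZ fK.
  have: f \in supp X :|: supp Y.
    rewrite in_setU !in_supp; case/orP: fZ => [/(subsetP Z1)|/(subsetP Z2)];
      by rewrite in_setU => /orP[]->; rewrite ?orbT.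
  by case/setUP=> fS; [rewrite (disjointFr XK fS) in fK|rewrite (disjointFr YK fS) in fK].
(* Both members are oriented to be positive at [a]; among such pairs one with the smallest
   separation set [sep] is chosen below. *)
pose good (q : signed_set T * signed_set T) :=
  [&& a \in q.1.1, a \in q.2.1
    & [exists x in R, exists y in R, [&& x != y, through K x q.1 & through K y q.2]]].
have normalize x X : x \in R -> through K x X ->
    exists2 Y, through K x Y & a \in Y.1.
  move=> xR Xx; have xa : x != a by rewrite eq_sym mnR.
  have : a \in supp X.
    have /and3P[Xc _ xX] := Xx.
    have := basisR _ _ (mW _ am) xR (mnR _ _ am xR); rewrite setUCA => xb.
    by have/setP/(_ a) := meet _ _ _ Xx xb; rewrite !inE eqxx orbT.
  rewrite in_supp => /orP[] aX; first by exists X.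
  by exists (sopp X); first exact: throughN.
have [X1 X1x aX1] := normalize _ _ x0R X0x.
have [Y1 Y1y aY1] := normalize _ _ y0R Y0y.
have good0 : good (X1, Y1).
  apply/and3P; split=> //; apply/exists_inP; exists x0 => //.
  by apply/exists_inP; exists y0 => //; apply/and3P.
case: (arg_minnP (fun q => #|sep q.1 q.2|) good0) => -[X Y] /=.
case/and3P=> /= aX aY /exists_inP[x xR /exists_inP[y yR /and3P[xy Xx Yy]]] minXY.
exists x, y, X, Y; split=> //.
have /and3P[Xc XK xX] := Xx; have /and3P[Yc YK yY] := Yy.
have yx : y != x by rewrite eq_sym.
have xY : x \in supp Y by apply: meetR Yy (RW _ yR) xR yx.
have yX : y \in supp X by apply: meetR Xx (RW _ xR) yR xy.
have sep0 e : e \notin sep X Y.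
  apply/negP=> eXY; have /setIP[eS eW] := eXY.
  have XsY : X <> sopp Y.
    by move=> XsY; move: aX; rewrite XsY => /= aY2; rewrite (negPf (notboth _ _ Yc aY)) in aY2.
  have [Z [Ze Z1 Z2]] := elim _ _ _ _ _ Xx Yy XsY eXY.
  have [em|eR] := setUP eW.
    (* Eliminating [e] from [X, Y] and [a] from [X, -Y] gives the cocircuit of
       the class [m] up to sign; the signs at [x] and [y] are contradictory. *)
    have Za := class _ _ _ Ze em am.
    have XY : X <> sopp (sopp Y).
      by rewrite soppK => XY; rewrite XY xY in xX.
    have aXY : a \in sep X (sopp Y) by rewrite !inE /= aX aY am.
    have [W [Wa W1 W2]] := elim _ _ _ _ _ Xx (throughN _ _ Yy) XY aXY.
    have xZ := meetR _ _ _ Za (mW _ am) xR (mnR _ _ am xR).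
    have yZ := meetR _ _ _ Za (mW _ am) yR (mnR _ _ am yR).
    have sub A B g : A \subset B -> g \in A -> g \in B by move/subsetP; apply.
    move: xX yY; rewrite !in_supp => /norP[/negPf xX1 /negPf xX2] /norP[/negPf yY1 /negPf yY2].
    case: (uniq _ _ _ Wa Za (mW _ am)) => eW'.
      move: W1 W2; rewrite eW' => W1 W2.
      move: xZ; rewrite in_supp => /orP[] xZ.
        have := sub _ _ _ Z1 xZ; have := sub _ _ _ W1 xZ; rewrite !in_setU xX1 /=.
        by move=> xY2 /(notboth _ _ Yc); rewrite xY2.
      have := sub _ _ _ Z2 xZ; have := sub _ _ _ W2 xZ; rewrite !in_setU xX2 /=.
      by move=> /(notboth _ _ Yc) /negPf ->.
    move: W1 W2; rewrite eW' /= => W1 W2.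
    move: yZ; rewrite in_supp => /orP[] yZ.
      have := sub _ _ _ Z1 yZ; have := sub _ _ _ W2 yZ; rewrite !in_setU yY1 !orbF.
      by move=> yX2 /(notboth _ _ Xc); rewrite yX2.
    have := sub _ _ _ Z2 yZ; have := sub _ _ _ W1 yZ; rewrite !in_setU yY2 !orbF.
    by move=> /(notboth _ _ Xc) /negPf ->.
  (* Here [e] is in [R], and [(X, Z)] is a better pair: [Z] is positive at [a], its signs come from
     [X] or [Y], and it vanishes at [e], so it is separated from [X] by strictly fewer elements. *)
  have /and3P[Zc ZK eZ] := Ze.
  have aZ : a \in Z.1.
    have := basisR _ _ (mW _ am) eR (mnR _ _ am eR); rewrite setUCA => xb.
    have/setP/(_ a) := meet _ _ _ Ze xb; rewrite in_setI in_supp !inE eqxx orbT /=.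
    case/orP=> // /(subsetP Z2); rewrite in_setU.
    by rewrite (negPf (notboth _ _ Xc aX)) (negPf (notboth _ _ Yc aY)).
  have xe : x != e.
    apply: contraNneq xX => ->; rewrite in_supp.
    by case/setUP: eS => /setIP[-> _]; rewrite ?orbT.
  have := minXY (X, Z); rewrite /good /= aX aZ /= leqNgt => /(_ _)/negP[].
    apply/exists_inP; exists x => //; apply/exists_inP; exists e => //.
    exact/and3P.
  apply: proper_card; rewrite properE; apply/andP; split; last first.
    apply/subsetPn; exists e => //; move: eZ; rewrite in_supp => /norP[/negPf eZ1 /negPf eZ2].
    by rewrite !inE eZ1 eZ2 !andbF.
  apply/subsetP=> g; rewrite !in_setI !in_setU !in_setI => /andP[gXZ ->]; rewrite andbT.
  case/orP: gXZ => /andP[gX gZ]; rewrite gX ?andbT /=.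
    move: (subsetP Z2 _ gZ); rewrite in_setU (negPf (notboth _ _ Xc gX)) /= => ->.
    by rewrite ?orbT.
  have gX1 : g \notin X.1 by apply: contraTN gX => /(notboth _ _ Xc).
  by move: (subsetP Z1 _ gZ); rewrite in_setU (negPf gX1) /= => ->; rewrite ?orbT.
move=> e eW ex ey.
have xe : x != e by rewrite eq_sym.
have eX : e \in supp X.
  case/setUP: eW => [em|eR]; last exact: meetR Xx (RW _ xR) eR xe.
  apply/negPn/negP => eX.
  have Xe : through K e X by rewrite /through Xc XK.
  by rewrite (meetR _ _ _ Xe (mW _ em) xR ex) in xX.
have eY : e \in supp Y.
  apply/negPn/negP => eY'.
  have Ye : through K e Y by rewrite /through Yc YK.
  by rewrite (meetR _ _ _ Ye eW yR ey) in yY.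
move: (sep0 e) eX eY; rewrite !in_supp in_setI eW andbT in_setU !in_setI.
have := notboth X e Xc; have := notboth Y e Yc.
by case: (e \in X.1); case: (e \in X.2); case: (e \in Y.1); case: (e \in Y.2) => // ->.
Qed.

End Bases.

(** * Bases and cocircuits of minors *)

Section Minors.

Variables (T : finType) (O : signed_system T) (r : nat) (A E : {set T}).
Hypothesis omO : oriented_matroid O.
Hypothesis card_basis : forall B, B \in bases (underlying O) -> #|B| = r.
Hypothesis disjAE : [disjoint A & E].
Implicit Types (D : signed_set T) (B Y Z : {set T}).

Local Notation basis B := (B \in bases (underlying O)).
Local Notation N := (delete (contract O A) E).
Local Notation G := (sground N).

Lemma in_minor_ground e :
  (e \in G) = [&& e \in sground O, e \notin A & e \notin E].
Proof. by rewrite !inE andbA andbC (andbC (e \notin E)). Qed.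

Lemma basis_sub_ground B : basis B -> B \subset sground O.
Proof.
move=> Bb; apply/subsetP=> h hB.
have [D Dc BD] := fundamental_cocircuit Bb hB.
apply: (subsetP (om_ground omO Dc)).
by have/setIP[] : h \in B :&: supp D by rewrite BD set11.
Qed.

Definition minor_basis Z Y := (Y \subset G) && basis (Y :|: Z).

(** As [A] and [E] are disjoint, this is 2 on [A], 0 on [E] and 1 elsewhere: a basis of maximal
    weight favours [A] and shuns [E]. *)
Definition weight e : nat := (e \in A) + (e \notin E).

(* Bases of [N] are traces on [G] of the bases of [O] extending a fixed [Z];
   for this, [Z] is the part outside [G] of a basis that is first as large as
   possible on [A], then as small as possible on [E]. *)
Record complementing Z : Prop := Complementing {
  compl_disjoint : [disjoint Z & G];
  compl_basis : exists Y, minor_basis Z Y;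
  compl_weight : forall Y z d, minor_basis Z Y -> z \in Y :|: Z ->
    d \notin Y :|: Z -> basis (d |: (Y :|: Z) :\ z) -> weight d <= weight z
}.

(** [Z] is the part outside [G] of a basis of maximal weight. All [Y] completing [Z] have the same
    size and elements of [G] weigh 1 each, so every [Y :|: Z] has maximal weight and no exchange can
    gain. *)
Lemma complementing_exists : (exists B, basis B) -> exists Z, complementing Z.
Proof.
case=> B1 B1b; pose wt B := \sum_(e in B) weight e.
case: (@arg_maxnP _ B1 (mem (bases (underlying O))) wt B1b) => B0 B0b maxB0.
have split0 : (B0 :&: G) :|: (B0 :\: G) = B0 by rewrite setID.
have disj : [disjoint B0 :\: G & G] by rewrite -setI_eq0 setIDAC setDIl setDv setI0.
exists (B0 :\: G); split=> //.
  by exists (B0 :&: G); rewrite /minor_basis subsetIr split0.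
move=> Y z d /andP[YG Yb] zYZ dYZ dz.
have wtG (X : {set T}) : X \subset G -> wt (X :|: B0 :\: G) = #|X| + wt (B0 :\: G).
  move=> XG; rewrite /wt (eq_bigl _ _ (fun e => in_setU e X _)) bigU /=; last first.
    by rewrite disjoint_sym; apply: disjointWr XG disj.
  congr (_ + _); rewrite -sum1_card; apply: eq_bigr => e /(subsetP XG).
  by rewrite in_minor_ground /weight => /and3P[_ /negPf-> ->].
have card (X : {set T}) : X \subset G -> basis (X :|: B0 :\: G) -> #|X| = r - #|B0 :\: G|.
  move=> XG /card_basis <-; rewrite cardsU (_ : X :&: _ = set0) ?cards0 ?subn0 ?addnK //.
  by apply/eqP; rewrite setI_eq0 disjoint_sym; apply: disjointWr XG disj.
have eqwt : wt (Y :|: B0 :\: G) = wt B0.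
  have := card (B0 :&: G) (subsetIr _ _); rewrite split0 => /(_ B0b) cB0.
  by rewrite wtG // (card Y YG Yb) -cB0 -wtG ?subsetIr // split0.
have := maxB0 _ dz; rewrite -eqwt /wt (big_setD1 z) //= big_setU1 /=.
  by rewrite leq_add2r.
by rewrite in_setD (negPf dYZ) andbF.
Qed.

Variable Z : {set T}.
Hypothesis complZ : complementing Z.

(** The leaving element cannot lie in [Z]: being outside [A] and [G] it would be in [E], of weight
    0, below the weight 1 of [g]. *)
Lemma minor_exchange Y D g : minor_basis Z Y -> D \in cocircuits O ->
    [disjoint supp D & A] -> g \in supp D -> g \in G -> g \notin Y ->
  exists z, [/\ z \in Y, z \in supp D & minor_basis Z (g |: Y :\ z)].
Proof.
move=> Yb Dc DA gD gG gY; have /andP[YG YZb] := Yb.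
have gZ : g \notin Z.
  by rewrite (disjointFl (compl_disjoint complZ)).
have gYZ : g \notin Y :|: Z by rewrite in_setU negb_or gY.
have [z [zYZ zD zb]] := cocircuit_exchange omO card_basis YZb Dc gD gYZ.
have lewt := compl_weight complZ Yb zYZ gYZ zb.
have zZ : z \notin Z.
  apply/negP=> zZ; have := disjointFr (compl_disjoint complZ) zZ.
  rewrite in_minor_ground (subsetP (basis_sub_ground YZb)) //= (disjointFr DA zD) /=.
  move: lewt gG; rewrite in_minor_ground /weight (disjointFr DA zD).
  by case: (z \in E) => //=; case: (g \in A); case: (g \in E); rewrite ?andbF.
have zY : z \in Y by move: zYZ; rewrite in_setU (negPf zZ) orbF.
exists z; split=> //; apply/andP; split.
  by rewrite subUset sub1set gG (subset_trans (subsetDl _ _)).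
move: zb; rewrite setDUl setUA (_ : Z :\ z = Z) //.
by apply/setDidPl; rewrite disjoint_sym disjoints1.
Qed.

Lemma minor_swap Y D h g : minor_basis Z Y -> h \in Y -> D \in cocircuits O ->
    (Y :|: Z) :&: supp D = [set h] -> g \in supp D -> g \in G ->
  minor_basis Z (g |: Y :\ h).
Proof.
move=> /andP[YG YZb] hY Dc YD gD gG.
rewrite /minor_basis subUset sub1set gG (subset_trans (subsetDl _ _)) //=.
have := basis_exchange omO card_basis YZb Dc YD gD.
rewrite setDUl setUA (_ : Z :\ h = Z) //.
apply/setDidPl; rewrite disjoint_sym disjoints1.
by rewrite (disjointFl (compl_disjoint complZ)) // (subsetP YG).
Qed.

(** An element of [A] in the fundamental cocircuit of [h] could replace [h] at a gain in weight. *)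
Lemma minor_fundamental Y h : minor_basis Z Y -> h \in Y ->
  exists D, [/\ D \in cocircuits O, (Y :|: Z) :&: supp D = [set h]
              & [disjoint supp D & A]].
Proof.
move=> Yb hY; have /andP[YG YZb] := Yb.
have hYZ : h \in Y :|: Z by rewrite in_setU hY.
have [D Dc YD] := fundamental_cocircuit YZb hYZ.
exists D; split=> //; apply/pred0P=> g /=; apply/negP=> /andP[gD gA].
have := subsetP YG _ hY; rewrite in_minor_ground => /and3P[_ hA hE].
have gYZ : g \notin Y :|: Z.
  apply: contraL gA => gYZ; suff /set1P-> : g \in [set h] by [].
  by rewrite -YD in_setI gYZ.
have := compl_weight complZ Yb hYZ gYZ
  (basis_exchange omO card_basis YZb Dc YD gD).
by rewrite /weight gA (negPf hA) hE (disjointFr disjAE gA).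
Qed.

Lemma supp_srestrict D B : supp (srestrict D B) = supp D :&: B.
Proof. by rewrite /supp /= setIUl. Qed.

(** The point is minimality of the restricted support. If [F] restricts to a proper part missing
    [g], put [g] in place of [h] in [Y]. Exchanging an element of [F] in must expel one that is in
    [F]; but off [E], [F] lies in [D], which meets [Y] only in [h]. *)
Lemma minor_cocircuit Y h D : minor_basis Z Y -> h \in Y ->
    D \in cocircuits O -> [disjoint supp D & A] ->
    (Y :|: Z) :&: supp D = [set h] ->
  srestrict D (~: E) \in cocircuits N.
Proof.
move=> Yb hY Dc DA YD; have /andP[YG YZb] := Yb.
have hD : h \in supp D.
  by have/setIP[] : h \in (Y :|: Z) :&: supp D by rewrite YD set11.
have inG e F : F \in cocircuits O -> [disjoint supp F & A] ->
    e \in supp F :&: ~: E -> e \in G.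
  move=> Fc FA /setIP[eF]; rewrite in_setC in_minor_ground => ->.
  by rewrite (subsetP (om_ground omO Fc)) // (disjointFr FA eF).
have onlyh e : e \in Y -> e \in supp D -> e = h.
  by move=> eY eD; apply/set1P; rewrite -YD in_setI in_setU eY.
rewrite inE; apply/and3P; split.
- by apply: imset_f; rewrite inE Dc.
- rewrite supp_srestrict; apply/set0Pn; exists h; rewrite in_setI hD in_setC.
  by have := subsetP YG _ hY; rewrite in_minor_ground => /and3P[].
apply/forall_inP=> F' /imsetP[F]; rewrite inE => /andP[Fc FA] ->.
apply/implyP; rewrite !supp_srestrict => /set0Pn[d dF].
apply/negP=> /properP[sFD [g gD gF]].
have gG := inG _ _ Dc DA gD; have dG := inG _ _ Fc FA dF.
have /setIP[dD _] := subsetP sFD _ dF.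
have gF' : g \notin supp F.
  by apply: contra gF => gF; case/setIP: gD => _ gE; rewrite in_setI gF.
have /setIP[dF' _] := dF; have /setIP[gD' _] := gD.
have Yb' := minor_swap Yb hY Dc YD gD' gG.
have dY : d \notin g |: Y :\ h.
  rewrite in_setU1 in_setD1; apply/norP; split.
    by apply: contraNneq gF' => <-.
  by apply/negP=> /andP[dh /onlyh eh]; rewrite eh ?eqxx in dh.
have [z [zY zF _]] := minor_exchange Yb' Fc FA dF' dG dY.
case/setU1P: zY => [eg|/setD1P[zh zY]]; first by rewrite -eg zF in gF'.
have /setIP[zD _] : z \in supp D :&: ~: E.
  apply: (subsetP sFD); rewrite in_setI zF in_setC.
  by have := subsetP YG _ zY; rewrite in_minor_ground => /and3P[].
by rewrite (onlyh z) ?eqxx in zh.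
Qed.

(** Simplicity puts [g] and [h] in a basis of [underlying N]. Its fundamental cocircuits separate
    the two, so [h] and then [g] can be exchanged into a [minor_basis], the second exchange leaving
    [h] in place. *)
Lemma simple_minor_pair g h : simple_matroid (underlying N) ->
  g \in G -> h \in G -> exists Y, [/\ minor_basis Z Y, g \in Y & h \in Y].
Proof.
move=> simN gG hG.
have: ~~ dependent (underlying N) [set g; h].
  apply/negP=> dep; have [C minC sC] := minset_exists dep.
  have := simN _ minC; rewrite ltnNge => /negP[].
  by apply: leq_trans (subset_leq_card sC) _; rewrite cards2; case: eqP.
rewrite /dependent subUset !sub1set gG hG !andTb negbK => /exists_inP[B Bb].
rewrite subUset !sub1set => /andP[gB hB].
have separating x : x \in B -> exists D, [/\ D \in cocircuits O,
    [disjoint supp D & A], x \in supp D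
    & forall y, y \in B -> y \in G -> y != x -> y \notin supp D].
  move=> xB; have [D Dc BD] := fundamental_cocircuit Bb xB.
  move: Dc BD; rewrite inE => /and3P[/imsetP[F]].
  rewrite inE => /andP[Fc FA] -> _ _; rewrite supp_srestrict => BF.
  exists F; split=> //.
    by have /setIP[_ /setIP[]] : x \in B :&: (supp F :&: ~: E) by rewrite BF set11.
  move=> y yB yG; apply: contra => yF; rewrite -in_set1 -BF !in_setI yB yF in_setC.
  by move: yG; rewrite in_minor_ground => /and3P[].
have [Y0 Y0b] := compl_basis complZ.
have [Y [Yb hY]] : exists Y, minor_basis Z Y /\ h \in Y.
  have [hY0|hY0] := boolP (h \in Y0); first by exists Y0.
  have [F [Fc FA hF _]] := separating h hB.
  have [z [_ _ zb]] := minor_exchange Y0b Fc FA hF hG hY0.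
  by exists (h |: Y0 :\ z); split=> //; apply: setU11.
have [gY|gY] := boolP (g \in Y); first by exists Y.
have gh : g != h by apply: contraNneq gY => ->.
have [D [Dc DA gD]] := separating g gB; move=> /(_ h hB hG) hD.
have [z [zY zD zb]] := minor_exchange Yb Dc DA gD gG gY.
exists (g |: Y :\ z); split; rewrite ?setU11 // in_setU1 in_setD1 hY andbT.
apply/orP; right; apply: contraTneq zD => <-.
by apply: hD; rewrite eq_sym.
Qed.

End Minors.

(** * Set systems given by bounds on initial segments *)

Section PathBounds.

Variables (T : finType) (pos : T -> nat).
Implicit Types (B C G : {set T}) (e g h : T).

(** When [B] is the set of north steps of a path, this is the height of the path after [k] steps. *)
Definition before k B : nat := #|[set e in B | pos e < k]|.

Lemma before_setU1 k e B :
  e \notin B -> before k (e |: B) = (pos e < k) + before k B.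
Proof.
move=> eB; rewrite /before [in LHS](cardsD1 e) !inE eqxx /=; congr addn.
apply: eq_card => x; rewrite !inE; case: eqVneq => //= ->.
by rewrite (negPf eB).
Qed.

Lemma leq_before k1 k2 B : k1 <= k2 -> before k1 B <= before k2 B.
Proof.
move=> le12; apply/subset_leq_card/subsetP=> e; rewrite !inE => /andP[->].
by move/leq_trans->.
Qed.

Lemma before_card k B C : C \subset B -> (forall e, e \in C -> k <= pos e) ->
  before k B + #|C| <= #|B|.
Proof.
move=> sCB geC; rewrite addnC -leq_subRL ?subset_leq_card // -cardsDS //.
apply/subset_leq_card/subsetP=> e; rewrite !inE => /andP[-> lte]; rewrite andbT.
by apply: contraL lte => /geC; rewrite -leqNgt.
Qed.

Lemma leq_before_card k B : before k B <= #|B|.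
Proof. by apply: subset_leq_card; apply/subsetP=> e /[!inE] /andP[]. Qed.

Lemma eq_before_card k B : (forall e, e \in B -> pos e < k) -> before k B = #|B|.
Proof.
move=> ltB; apply: eq_card => e; rewrite inE.
by case: (boolP (e \in B)) => //= /ltB.
Qed.

Variables (G : {set T}) (rho : nat) (lo hi : nat -> nat) (basis : pred {set T}).
Hypothesis pos_inj : {in G &, injective pos}.
Hypothesis basisP : forall B, basis B <->
  [/\ B \subset G, #|B| = rho & forall k, lo k <= before k B <= hi k].

Lemma beforeS k B : B \subset G ->
  before k.+1 B = before k B + [exists e in B, pos e == k].
Proof.
move=> /subsetP sBG; rewrite /before.
have -> : [set e in B | pos e < k.+1] =
    [set e in B | pos e < k] :|: [set e in B | pos e == k].
  by apply/setP=> e; rewrite !inE ltnS leq_eqVlt orbC -andb_orr.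
rewrite cardsU (_ : _ :&: _ = set0) ?cards0 ?subn0; last first.
  by apply/setP=> e; rewrite !inE; case: ltngtP; rewrite ?andbF.
congr (_ + _); case: exists_inP => [[e eB /eqP ek]|no].
  rewrite (_ : [set _ in _ | _] = [set e]) ?cards1 //; apply/setP=> x; rewrite !inE.
  apply/andP/eqP=> [[xB /eqP xk]|->]; last by rewrite ek eqxx.
  by apply: pos_inj; rewrite ?sBG // ek.
apply/eqP; rewrite cards_eq0; apply/set0Pn=> -[e]; rewrite inE => /andP[eB ek].
by apply: no; exists e.
Qed.

(* The coline is spanned by the leftmost [rho - 2] elements. Its copoints are
   single elements, except that the elements that can be the last but one, but
   not the last, element of a basis all lie in one copoint. *)
Lemma lattice_coline :
    G != set0 ->
    (forall g h, g \in G -> h \in G -> exists Y, [/\ basis Y, g \in Y & h \in Y]) ->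
  (exists z Y, [/\ basis Y, z \in Y & forall X, basis X -> z \in X]) \/
  exists (U m R : {set T}) a x y, [/\
    [/\ m \subset G, R \subset G, U \subset G :\: (m :|: R) & [disjoint m & R]],
    [/\ a \in m, x \in R, y \in R & x != y],
    forall g h, g \in m :|: R -> h \in R -> g != h -> basis (g |: (h |: U)),
    forall g h, g \in m -> h \in m -> ~~ basis (g |: (h |: U))
    & forall g h, g \in G :\: (m :|: R) -> ~~ basis (g |: (h |: U))].
Proof.
case/set0Pn=> g0 g0G pairs.
have [Y0 [Y0b gY0 _]] := pairs _ _ g0G g0G.
have sub Y : basis Y -> Y \subset G by case/basisP.
have card Y : basis Y -> #|Y| = rho by case/basisP.
have loP k Y : basis Y -> lo k <= before k Y by case/basisP=> _ _ /(_ k)/andP[].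
have hiP k Y : basis Y -> before k Y <= hi k by case/basisP=> _ _ /(_ k)/andP[].
(* [s] is the earliest position that the [n]-th element of a basis can take; [Y] attains it with
   [z]. *)
have first n : 0 < n <= rho -> exists s z Y, [/\ basis Y, z \in Y, pos z = s,
    before s Y = n.-1 & forall X, basis X -> before s X < n].
  case/andP=> n0 lenr; pose P k := [exists Y, basis Y && (n <= before k Y)].
  have exP : exists k, P k.
    exists (\max_e pos e).+1; apply/existsP; exists Y0; rewrite Y0b.
    by rewrite eq_before_card ?card // => e _; rewrite ltnS leq_bigmax.
  case: (ex_minnP exP) => -[|s] /existsP[Y /andP[Yb leY]] mins.
    move: leY; rewrite leqNgt; case/negP; apply: leq_trans n0.
    by rewrite ltnS leqn0 cards_eq0; apply/eqP/setP=> e; rewrite !inE andbF.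
  have lts X : basis X -> before s X < n.
    move=> Xb; rewrite ltnNge; apply/negP=> leX.
    suff: s < s by rewrite ltnn.
    by apply: mins; apply/existsP; exists X; rewrite Xb.
  have := lts _ Yb; move: leY; rewrite beforeS ?sub //.
  case: exists_inP => [[z zY /eqP zs]|_]; last by rewrite addn0 leqNgt => /negP.
  rewrite addn1 => le1 le2; exists s, z, Y; split=> //.
  by apply/eqP; rewrite eqn_leq -ltnS prednK // le2 -ltnS prednK.
have rho0 : 0 < rho by rewrite -(card _ Y0b); apply/card_gt0P; exists g0.
have [|s2 [z [Y2 [Y2b zY2 zs2 Y2s2 lts2]]]] := first rho; first by rewrite rho0 /=.
pose R := [set e in G | s2 <= pos e].
have zR : z \in R by rewrite inE zs2 leqnn (subsetP (sub _ Y2b)).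
(* If [z] is alone in [R] it is in every basis, as no basis has all its [rho] elements before
   [s2]. *)
have [/subsetP R1|/subsetPn[y yR]] := boolP (R \subset [set z]).
  left; exists z, Y2; split=> // X Xb.
  have := lts2 X Xb; rewrite -(card _ Xb) => /negPn; apply: contraNT => zX.
  rewrite -leqNgt eq_before_card // => e eX; rewrite ltnNge.
  apply: contra zX => se; suff /R1/set1P <- : e \in R by [].
  by rewrite inE se (subsetP (sub _ Xb)).
rewrite in_set1 => yz; right.
have RG : {subset R <= G} by move=> e /[!inE] /andP[].
have rho1 : 1 < rho.
  have [Y [Yb zY yY]] := pairs _ _ (RG _ zR) (RG _ yR).
  rewrite -(card _ Yb) (cardsD1 z) zY (cardsD1 y) !inE yz yY; by [].
have [|s1 [a [Y1 [Y1b aY1 as1 Y1s1 lts1]]]] := first rho.-1.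
  by rewrite leq_pred andbT -ltnS prednK.
have rho0E : rho.-1.+1 = rho by rewrite prednK.
have rho1E : rho.-2.+1 = rho.-1 by rewrite prednK // -ltnS rho0E.
have lts12 : s1 < s2.
  rewrite ltnNge; apply/negP=> /(leq_before Y2)/leq_ltn_trans/(_ (lts1 _ Y2b)).
  by rewrite Y2s2 ltnn.
pose m := [set e in G | s1 <= pos e < s2].
pose U := [set e in Y1 | pos e < s1].
have inW e : (e \in m :|: R) = (e \in G) && (s1 <= pos e).
  rewrite !inE -andb_orr; congr (_ && _); case: (ltnP (pos e) s2) => [|le2].
    by rewrite andbT orbF.
  by rewrite andbF /= (leq_trans (ltnW lts12)).
have inL e : (e \in G :\: (m :|: R)) = (e \in G) && (pos e < s1).
  by rewrite in_setD inW negb_and ltnNge; case: (e \in G); rewrite ?orbF ?andbF ?andbT.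
have UG : U \subset G by apply: subset_trans (sub _ Y1b); apply/subsetP=> e /[!inE] /andP[].
have cardU : #|U| = rho.-2 by [].
(* The bounds are checked for each [k]. Up to [s1] the set counts like [Y1]. Beyond, lower bounds
   come from a basis [X] containing [g] and [h], upper bounds from [Y1] while [k <= pos h] and from
   [Y2] afterwards. *)
have basisgh g h : g \in G -> h \in G -> s1 <= pos g -> s2 <= pos h ->
    pos g < pos h -> basis (g |: (h |: U)).
  move=> gG hG sg sh gh; have [X [Xb gX hX]] := pairs _ _ gG hG.
  have hU : h \notin U by rewrite !inE negb_and -leqNgt (leq_trans (ltnW lts12) sh) orbT.
  have gU : g \notin h |: U.
    rewrite !inE negb_or negb_and -leqNgt sg orbT andbT.
    by apply: contraTneq gh => ->; rewrite ltnn.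
  apply/basisP; split=> [||k].
  - by rewrite !subUset !sub1set gG hG.
  - by rewrite !cardsU1 gU hU cardU; case: rho rho1 => [|[]].
  rewrite !before_setU1 //; have [les|lts] := leqP k s1.
    rewrite !ltnNge (leq_trans les sg) (leq_trans les (leq_trans sg (ltnW gh))) /=.
    rewrite !add0n (_ : before k U = before k Y1) ?loP ?hiP //.
    apply: eq_card => e; rewrite !inE -andbA; congr (_ && _).
    by rewrite andbC; apply: andb_idr => /leq_trans; apply.
  rewrite (@eq_before_card k U) ?cardU; last first.
    by move=> e /[!inE] /andP[_ /ltn_trans]; apply.
  have Y1k : rho.-1 <= before k Y1.
    apply: leq_trans (leq_before _ lts); rewrite beforeS ?sub // Y1s1.
    case: exists_inP => [_|[]]; last by exists a; rewrite ?as1.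
    by rewrite addn1; case: rho rho1 => [|[]].
  have Xg : k <= pos g -> before k X + 2 <= rho.
    move=> kg; rewrite -(card _ Xb); have <- : #|[set g; h]| = 2.
      by rewrite cards2; case: eqVneq gh => // ->; rewrite ltnn.
    apply: before_card; first by rewrite subUset !sub1set gX.
    by move=> e /set2P[]->//; apply: leq_trans kg (ltnW gh).
  have Xh : k <= pos h -> before k X + 1 <= rho.
    move=> kh; rewrite -(card _ Xb) -(cards1 h); apply: before_card; first by rewrite sub1set.
    by move=> e /set1P->.
  have [kg|gk] := leqP k (pos g).
    rewrite ltnNge (leq_trans kg (ltnW gh)) /= !add0n; apply/andP; split.
      by apply: leq_trans (loP k _ Xb) _; rewrite -subn2 leq_subRL // addnC Xg.
    apply: leq_trans (hiP k _ Y1b); apply: leq_trans Y1k; exact: leq_pred.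
  have [kh|hk] := leqP k (pos h).
    rewrite add1n rho1E; apply/andP; split; last exact: leq_trans (hiP k _ Y1b).
    by apply: leq_trans (loP k _ Xb) _; rewrite -ltnS rho0E -addn1 Xh.
  rewrite !add1n rho1E rho0E; apply/andP; split.
    by apply: leq_trans (loP k _ Xb) _; rewrite -(card _ Xb) leq_before_card.
  apply: leq_trans (hiP k _ Y2b); apply: leq_trans (leq_before _ (_ : s2.+1 <= k)).
    rewrite beforeS ?sub // Y2s2; case: exists_inP => [_|[]]; last by exists z; rewrite ?zs2.
    by rewrite addn1 rho0E.
  exact: leq_ltn_trans hk.
exists U, m, R, a, z, y; split.
- split.
  + by apply/subsetP=> e /[!inE] /andP[].
  + exact/subsetP.
  + by apply/subsetP=> e eU; rewrite inL (subsetP UG) //; move: eU => /[!inE] /andP[].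
  + apply/pred0P=> e /=; rewrite !inE; case: (e \in G) => //=.
    by case: ltnP; rewrite ?andbF.
- split=> //; last by rewrite eq_sym.
  by rewrite inE as1 leqnn lts12 (subsetP (sub _ Y1b)).
- move=> g h; rewrite inW => /andP[gG sg]; rewrite inE => /andP[hG sh] gh.
  have [lt|lt|/pos_inj eq] := ltngtP (pos g) (pos h).
  + exact: basisgh.
  + rewrite setUCA; apply: basisgh => //; last exact: leq_trans (ltnW lt).
    exact: leq_trans (ltnW lts12) sh.
  + by rewrite eq ?eqxx in gh.
- move=> g h; rewrite !inE => /and3P[gG _ gs] /and3P[hG _ hs].
  (* All [rho] elements of such a basis would come before [s2]. *)
  apply/negP=> Bb; have := lts2 _ Bb; rewrite eq_before_card ?card ?ltnn //.
  move=> e /setU1P[->|/setU1P[->|]] //; rewrite inE => /andP[_ /ltn_trans].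
  exact.
move=> g h; rewrite inL => /andP[gG gs]; apply/negP=> Bb.
have hV : h \notin g |: U.
  apply/negP=> hV; have := card _ Bb; rewrite setUCA cardsU1 hV cardsU1 cardU.
  apply/eqP; rewrite neq_ltn; apply/orP; left; rewrite add0n -[X in _ < X]rho0E ltnS -rho1E.
  by rewrite -add1n leq_add2r leq_b1.
(* Here the [rho - 1] elements of [g |: U] would come before [s1]. *)
have := lts1 _ Bb; rewrite setUCA before_setU1 // (@eq_before_card s1 (g |: U)).
  have := card _ Bb; rewrite setUCA cardsU1 hV => <-; rewrite ltnNge leq_addl; by [].
by move=> e /setU1P[->|] //; rewrite inE => /andP[].
Qed.

End PathBounds.

(** * Lattice path matroids as systems of bounds *)

Lemma count_take (s : seq bool) k :
  count id (take k s) = \sum_(i < size s) (nth false s i && (i < k)).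
Proof.
elim: s k => [|x s IHs] [|k] /=; rewrite ?big_ord0 //.
  by rewrite big1 // => i _; rewrite andbF.
by rewrite big_ord_recl /= IHs andbT.
Qed.

Lemma before_north_steps n (R : n.-tuple bool) k :
  before val k (north_steps R) = height R k.
Proof.
rewrite /height count_take size_tuple /before -sum1_card big_mkcond /=.
by apply: eq_bigr => i _; rewrite !inE (tnth_nth false); case: (_ && _).
Qed.

Lemma never_aboveP n (P Q : n.-tuple bool) :
  reflect (forall k, height P k <= height Q k) (never_above P Q).
Proof.
apply: (iffP forallP) => [PQ k|PQ k]; last exact: PQ.
have [lek|ltk] := leqP k n; first exact: (PQ (Ordinal (lek : k < n.+1))).
have := PQ ord_max; by rewrite /height /= !take_oversize ?size_tuple // ltnW.
Qed.

(** The heights of [P] and [Q] are the bounds, and the isomorphism carries the order of the steps to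
    [pos]. Conversely, the membership function of a set within the bounds is the step sequence of a
    path. *)
Lemma lattice_path_bounds (T : finType) (M : basis_system T) :
    lattice_path_matroid M ->
  exists pos p q r, [/\ {in ground M &, injective pos},
    forall B, (B \in bases M) <-> [/\ B \subset ground M, #|B| = r
      & forall k, p k <= before pos k B <= q k]
    & exists B, B \in bases M].
Proof.
case=> m [r [P [Q [Pr Qr PQ [f [/= f_inj fG fB]]]]]].
have finj : injective f by move=> i j; apply: f_inj; rewrite inE.
(* Elements outside the image of [f], which is the ground set, get the default value 0; injectivity
   is only claimed on the ground set. *)
pose pos e : nat := if [pick i | f i == e] is Some i then val i else 0.
have posf i : pos (f i) = i.
  rewrite /pos; case: pickP => [j /eqP/finj-> //|/(_ i)]; by rewrite eqxx.
have beforef k (S : {set 'I_(m + r)}) : before pos k (f @: S) = before val k S.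
  rewrite /before -(card_imset _ finj); apply: eq_card => e; rewrite inE.
  apply/andP/imsetP => [[/imsetP[i iS ->]]|[i]]; rewrite ?posf.
    by move=> ik; exists i; rewrite // inE iS.
  by rewrite inE => /andP[iS ik] ->; rewrite posf imset_f.
have count_height (R : (m + r).-tuple bool) : count id R = height R (m + r).
  by rewrite /height take_oversize ?size_tuple.
have card_north (R : (m + r).-tuple bool) : #|north_steps R| = count id R.
  rewrite count_height -before_north_steps; apply: eq_card => i.
  by rewrite [in RHS]inE ltn_ord andbT.
exists pos, (height P), (height Q), r; split.
- rewrite -fG => _ _ /imsetP[i _ ->] /imsetP[j _ ->]; rewrite !posf.
  by move/val_inj->.
- move=> B; rewrite fB; split.
    case/imsetP=> S /imsetP[R]; rewrite inE => /and3P[/eqP Rr /never_aboveP PR /never_aboveP RQ] -> ->.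
    split=> [||k]; first by rewrite -fG imsetS ?subsetT.
      by rewrite card_imset // card_north.
    by rewrite beforef before_north_steps PR RQ.
  case=> BG cB bounds; pose S := f @^-1: B.
  have eB : f @: S = B.
    apply/setP=> e; apply/imsetP/idP=> [[i] /[!inE] iB -> //|eB].
    have := subsetP BG e eB; rewrite -fG => /imsetP[i _ ei].
    by exists i; rewrite // inE -ei.
  pose R := [tuple i \in S | i < m + r].
  have eS : north_steps R = S by apply/setP=> i; rewrite inE tnth_mktuple.
  apply/imsetP; exists S => //; apply/imsetP; exists R => //; rewrite inE.
  apply/and3P; split.
  + by rewrite /lattice_path -card_north eS -(card_imset _ finj) eB cB.
  + apply/never_aboveP=> k; rewrite -(before_north_steps R) eS -beforef eB.
    by case/andP: (bounds k).
  + apply/never_aboveP=> k; rewrite -(before_north_steps R) eS -beforef eB.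
    by case/andP: (bounds k).
exists (f @: north_steps P); rewrite fB imset_f // imset_f // inE Pr PQ andbT.
exact/never_aboveP.
Qed.

(** * Coflows with at most two nonzero entries *)

Section Coflows.

Import GRing.Theory.
Local Open Scope ring_scope.
Variables (T : finType) (O : signed_system T).
Implicit Types (D : signed_set T) (v w : {ffun T -> int}).

Lemma coflow_cocircuit D : D \in cocircuits O -> coflow O (signed_vector D).
Proof.
move=> Dc; exists (fun F => (F == D)%:R); rewrite (bigD1 D) //= eqxx mulr1z.
by rewrite big1 ?addr0 // => F /andP[_ /negPf->]; rewrite mulr0z.
Qed.

Lemma coflowB v w : coflow O v -> coflow O w -> coflow O (v - w).
Proof.
move=> [c ->] [d ->]; exists (fun D => c D - d D).
by rewrite -sumrB; apply: eq_bigr => D _; rewrite mulrzBr.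
Qed.

Lemma signed_vector_eq0 D e : (signed_vector D e == 0) = (e \notin supp D).
Proof. by rewrite ffunE in_supp; case: (e \in D.1) => //=; case: (e \in D.2). Qed.

Lemma signed_vector_sign D e :
  (signed_vector D e \in [:: 0; 1; -1]) && (- signed_vector D e \in [:: 0; 1; -1]).
Proof. by rewrite ffunE; case: (e \in D.1) => //=; case: (e \in D.2). Qed.

Lemma small_coflow_single D z : D \in cocircuits O -> supp D = [set z] ->
  exists v, [/\ coflow O v, forall e, v e \in [:: 0; 1; -1], v != 0
    & (#|[set e | v e != 0%R]| <= 2)%N].
Proof.
move=> Dc Dz; exists (signed_vector D); split.
- exact: coflow_cocircuit.
- by move=> e; case/andP: (signed_vector_sign D e).
- apply/eqP=> /ffunP/(_ z)/eqP; rewrite [X in _ == X]ffunE signed_vector_eq0 Dz.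
  by rewrite set11.
rewrite (_ : [set _ | _] = [set z]) ?cards1 //.
by apply/setP=> e; rewrite inE signed_vector_eq0 negbK Dz.
Qed.

(** The difference of the signed vectors cancels off [x] and [y]. At each of these one vector
    vanishes, so no entry exceeds 1 in absolute value, and the entry at [x] is nonzero. *)
Lemma small_coflow_pair D1 D2 x y :
    D1 \in cocircuits O -> D2 \in cocircuits O ->
    x \notin supp D1 -> x \in supp D2 -> y \notin supp D2 ->
    (forall e, e != x -> e != y ->
      (e \in D1.1) = (e \in D2.1) /\ (e \in D1.2) = (e \in D2.2)) ->
  exists v, [/\ coflow O v, forall e, v e \in [:: 0; 1; -1], v != 0
    & (#|[set e | v e != 0%R]| <= 2)%N].
Proof.
move=> D1c D2c xD1 xD2 yD2 agree.
have vx : (signed_vector D1 - signed_vector D2) x = - signed_vector D2 x.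
  by rewrite !ffunE; move: xD1; rewrite in_supp => /norP[/negPf-> /negPf->]; rewrite sub0r.
have vy : (signed_vector D1 - signed_vector D2) y = signed_vector D1 y.
  by rewrite !ffunE; move: yD2; rewrite in_supp => /norP[/negPf-> /negPf->]; rewrite subr0.
have v0 e : e != x -> e != y -> (signed_vector D1 - signed_vector D2) e = 0.
  by move=> ex ey; have [e1 e2] := agree e ex ey; rewrite !ffunE e1 e2 subrr.
exists (signed_vector D1 - signed_vector D2); split.
- by apply: coflowB; apply: coflow_cocircuit.
- move=> e; have [->|ex] := eqVneq e x.
    by rewrite vx; case/andP: (signed_vector_sign D2 x).
  have [->|ey] := eqVneq e y; first by rewrite vy; case/andP: (signed_vector_sign D1 y).
  by rewrite v0.
- apply/eqP=> /ffunP/(_ x)/eqP; rewrite vx [X in _ == X]ffunE oppr_eq0.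
  by rewrite signed_vector_eq0 xD2.
apply: leq_trans (_ : #|[set x; y]| <= 2)%N; last by rewrite cards2; case: eqP.
apply/subset_leq_card/subsetP=> e; rewrite !inE; apply: contraNT.
by rewrite negb_or => /andP[ex ey]; rewrite v0.
Qed.

End Coflows.

(** * Small coflows in the simple minors *)

Theorem proposition24 (T : finType) (M : basis_system T) (O : signed_system T)
  (M_lpm : lattice_path_matroid M) (O_orients_M : orientation_of O M) :
  GSP O.
Proof.
case: O_orients_M => omO eM; subst M.
have [pos [p [q [r [pos_inj basisP ex_basis]]]]] := lattice_path_bounds M_lpm.
have cardb B : B \in bases (underlying O) -> #|B| = r by case/basisP.
move=> _ [A [E [AG EG disjAE ->]]] simN N0.
set N := delete _ _ in simN N0 *.
have [Z complZ] := complementing_exists A E cardb ex_basis.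
have GO : {subset sground N <= sground O}.
  by move=> e; rewrite in_minor_ground => /andP[].
have disjZ (Y : {set T}) : Y \subset sground N -> Y :&: Z = set0.
  move=> YG; apply/eqP; rewrite setI_eq0; apply: disjointWl YG _.
  by rewrite disjoint_sym; apply: compl_disjoint complZ.
have [Y0 /andP[Y0G Y0b]] := compl_basis complZ.
have beforeU k (Y : {set T}) : Y \subset sground N ->
    before pos k (Y :|: Z) = before pos k Y + before pos k Z.
  move=> /disjZ YZ; rewrite /before.
  have -> : [set e in Y :|: Z | pos e < k] =
      [set e in Y | pos e < k] :|: [set e in Z | pos e < k].
    by apply/setP=> e; rewrite !inE andb_orl.
  rewrite cardsU.
  rewrite (_ : _ :&: _ = set0) ?cards0 ?subn0 //; apply/setP=> e.
  by move/setP/(_ e): YZ; rewrite !inE; case: (e \in Y); case: (e \in Z); rewrite ?andbF.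
have cardU (Y : {set T}) : Y \subset sground N -> #|Y :|: Z| = #|Y| + #|Z|.
  by move=> /disjZ YZ; rewrite cardsU YZ cards0 subn0.
have ZO : Z \subset sground O.
  by have := basis_sub_ground omO Y0b; rewrite subUset => /andP[].
(* This makes the truncated subtraction in the upper bound of [minorP] faithful. *)
have ZqP k : before pos k Z <= q k.
  have /basisP[_ _ /(_ k)/andP[_]] := Y0b; rewrite beforeU //.
  exact: leq_trans (leq_addl _ _).
have leZ : #|Z| <= r by rewrite -(cardb _ Y0b) cardU // leq_addl.
(* Fixing [Z] shifts both bounds by the count of [Z] in each initial segment. *)
have minorP Y : minor_basis O A E Z Y <-> [/\ Y \subset sground N,
    #|Y| = r - #|Z| & forall k,
    p k - before pos k Z <= before pos k Y <= q k - before pos k Z].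
  have bounds k : Y \subset sground N ->
      (p k <= before pos k (Y :|: Z) <= q k) =
      (p k - before pos k Z <= before pos k Y <= q k - before pos k Z).
    by move=> YG; rewrite beforeU // leq_subLR addnC leq_subRL // (addnC _ (before pos k Y)).
  split=> [/andP[YG /basisP[_ cY bY]]|[YG cY bY]].
    by split=> // [|k]; rewrite -?bounds // -cY cardU // addnK.
  rewrite /minor_basis YG; apply/basisP; split=> [||k]; last by rewrite bounds.
    rewrite subUset ZO andbT; apply/subsetP=> e /(subsetP YG); exact: GO.
  by rewrite cardU // cY subnK.
have posN : {in sground N &, injective pos}.
  by move=> g h /GO gO /GO hO; apply: pos_inj.
have pairs g h := simple_minor_pair omO cardb complZ (g := g) (h := h) simN.
have [[z [Y [Yb zY allz]]]|] := lattice_coline posN minorP N0 pairs.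
  (* Coloop case: any element of the minor in the cocircuit of [z] could replace [z] in [Y], yet [z]
     is in every basis; so this cocircuit restricts to [z] alone. *)
  have [D [Dc YD DA]] := minor_fundamental omO cardb disjAE complZ Yb zY.
  have DN := minor_cocircuit omO cardb complZ Yb zY Dc DA YD.
  apply: (small_coflow_single (z := z) DN); rewrite supp_srestrict.
  have zD : z \in supp D.
    by have /setIP[] : z \in (Y :|: Z) :&: supp D by rewrite YD set11.
  have zG : z \in sground N by case/andP: Yb => /subsetP->.
  apply/eqP; rewrite eqEsubset sub1set in_setI zD in_setC.
  have := zG; rewrite in_minor_ground => /and3P[_ _ ->]; rewrite !andbT.
  apply/subsetP=> e /setIP[eD eE].
  have eG : e \in sground N.
    rewrite in_minor_ground (subsetP (om_ground omO Dc)) // (disjointFr DA eD).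
    by rewrite in_setC in eE.
  have := allz _ (minor_swap omO cardb complZ Yb zY Dc YD eD eG).
  by rewrite in_setU1 in_setD1 eqxx orbF in_set1 eq_sym.
case=> U [m [R [a [x [y [[mG RG UL mR] [am xR yR xy] basisR basism basisL]]]]]].
(* Avoiding [A] lets a cocircuit survive the contraction; avoiding the ground elements of [N]
   outside [m :|: R] confines its restriction to [m :|: R]. *)
pose K := A :|: Z :|: (sground N :\: (m :|: R)).
have minor_bases g h : g |: (h |: (U :|: Z)) = g |: (h |: U) :|: Z by rewrite !setUA.
have UG : U \subset sground N by apply: subset_trans UL (subsetDl _ _).
have IK : U :|: Z \subset K.
  rewrite subUset; apply/andP; split; first exact: subset_trans UL (subsetUr _ _).
  by apply: subset_trans (subsetUl _ _); apply: subsetUr.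
have aG := subsetP mG _ am.
have aR : a \notin R by rewrite (disjointFr mR).
have ax g : g \in R -> a != g by apply: contraTneq => <-.
have basisa g : g \in R -> minor_basis O A E Z (a |: (g |: U)).
  by move=> gR; apply: basisR => //; rewrite ?in_setU ?am // ax.
(* The fundamental cocircuit of [a] in the basis formed by [a], [g], [U] and [Z] works: an element
   of [N] outside [m :|: R] in its support could replace [a], against [basisL]. *)
have ex_through g : g \in R -> exists X, through O K g X.
  move=> gR; have ag := ax _ gR.
  have aV : a \in a |: (g |: U) by rewrite setU11.
  have [D [Dc YD DA]] := minor_fundamental omO cardb disjAE complZ (basisa _ gR) aV.
  have only e : e \in a |: (g |: U) :|: Z -> e \in supp D -> e = a.
    by move=> eV eD; apply/set1P; rewrite -YD in_setI eV.
  exists D; apply/and3P; split=> //; last first.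
    by apply: contra ag => gD; rewrite eq_sym (only g) // !inE eqxx ?orbT.
  apply/pred0P=> e /=; apply/negP=> /andP[eD].
  case/setUP=> [/setUP[eA|eZ]|eL]; first by rewrite (disjointFr DA eD) in eA.
    have := disjointFr (compl_disjoint complZ) eZ.
    by rewrite (only e) ?aG // in_setU eZ orbT.
  have eG : e \in sground N by case/setDP: eL.
  have := minor_swap omO cardb complZ (basisa _ gR) aV Dc YD eD eG.
  rewrite setU1K; last first.
    rewrite in_setU1 negb_or ag; apply/negP=> /(subsetP UL).
    by rewrite in_setD in_setU am.
  by apply/negP/basisL.
have [X0 X0x] := ex_through x xR; have [Y0' Y0y] := ex_through y yR.
have [||x1 [y1 [X [Y [[x1R y1R xy1] Xx Yy agree]]]]] :=
    coline_agreement omO cardb IK am mR _ _ xR yR xy X0x Y0y.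
- by move=> g h gW hR gh; rewrite minor_bases; case/andP: (basisR g h gW hR gh).
- move=> g h gm hm; rewrite minor_bases; apply: contra (basism g h gm hm) => gb.
  by rewrite /minor_basis gb !subUset !sub1set UG !(subsetP mG).
have in_cocircuits g D : g \in R -> through O K g D ->
    srestrict D (~: E) \in cocircuits N.
  move=> gR Dg; have /and3P[Dc DK _] := Dg; have gb := basisa g gR.
  apply: (minor_cocircuit omO cardb complZ gb (setU11 a _) Dc).
    by apply: disjointWr DK; rewrite /K -setUA subsetUl.
  rewrite -minor_bases setUCA; apply: through_meets IK Dg _.
  by rewrite setUCA minor_bases; case/andP: gb.
have x1G := subsetP RG _ x1R; have y1G := subsetP RG _ y1R.
have x1Y : x1 \in supp Y.
  have := basisR y1 x1; rewrite in_setU y1R orbT eq_sym => /(_ isT x1R xy1).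
  rewrite /minor_basis -minor_bases => /andP[_ yb].
  have /setIP[] // : x1 \in (y1 |: (x1 |: (U :|: Z))) :&: supp Y.
  by rewrite (through_meets IK Yy yb) set11.
have /and3P[Xc XK xX] := Xx; have /and3P[Yc YK yY] := Yy.
apply: (small_coflow_pair (x := x1) (y := y1) (in_cocircuits _ _ x1R Xx) (in_cocircuits _ _ y1R Yy)).
- by rewrite supp_srestrict in_setI (negPf xX).
- rewrite supp_srestrict in_setI x1Y in_setC.
  by move: x1G; rewrite in_minor_ground => /and3P[].
- by rewrite supp_srestrict in_setI (negPf yY).
move=> e ex ey; rewrite /= !in_setI in_setC; case: (boolP (e \in E)) => eE.
  by rewrite !andbF.
rewrite !andbT; have [eW|eW] := boolP (e \in m :|: R); first exact: agree.
(* A support element outside [E] and [m :|: R] would lie in [A] or in the ground set of [N], hence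
   in [K]. *)
have off D : D \in cocircuits O -> [disjoint supp D & K] -> e \notin supp D.
  move=> Dc DK; apply/negP=> eD; have := disjointFr DK eD.
  rewrite /K !in_setU in_setD eW in_minor_ground eE andbT.
  by rewrite (subsetP (om_ground omO Dc)) //; case: (e \in A); rewrite ?orbT.
have := off _ Xc XK; have := off _ Yc YK; rewrite !in_supp.
by move=> /norP[/negPf-> /negPf->] /norP[/negPf-> /negPf->].
Qed.
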